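(* Let $\Bbbk$ be an infinite field, let $t\in\Bbbk$, and let $\mathbf{a}=(a_0,\dots,a_n)\in\mathbb{Z}_{\ge 0}^{n+1}$ be a sequence of $n+1$ nonnegative integers with $d=|\mathbf{a}|=\sum_{i=0}^n a_i$. Then the following identity holds in $\Bbbk[X_0,\dots,X_n]$: $$D_{\mathbf{a}}\cdot X_0^{a_0}X_1^{a_1}\cdots X_n^{a_n}=\sum_{Z_{\mathbf{a}}\subset A\subset E_{\mathbf{a}}}\ \sum_{\mathbf{k}\in\overline{K_A}}\ \sum_{\mathbf{s}\in\overline{S_A}}\overline{C_{A,\mathbf{k},\mathbf{s}}}\,(\ell_{A,\mathbf{k},\mathbf{s}})^d,$$ where $$D_{\mathbf{a}}=(-1)^{|Z_{\mathbf{a}}|}\cdot 2^n\cdot\binom{d}{\mathbf{a}}\cdot\prod_{i\notin Z_{\mathbf{a}}}F_i(t^{a_i})$$ and $$\overline{C_{A,\mathbf{k},\mathbf{s}}}=\sum_{j=0}^{\min\{m_i-k_i\}_{i\notin A}}t^{d\cdot j}\,C_{A,\mathbf{k}+j\cdot\mathbf{1},\mathbf{s}}.$$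
   Context: All indices $i$ range over $\{0,1,\dots,n\}$; ''$i\notin A$'' means $i\in\{0,\dots,n\}\setminus A$. Inclusions $\subset$ are not necessarily strict. Empty products equal $1$, and $0^0=1$. $\mathbf{1}$ denotes the tuple $(1)_{i\notin A}$ with all entries $1$. For $\mathbf{a}=(a_0,\dots,a_n)\in\mathbb{Z}_{\ge0}^{n+1}$: - $\binom{d}{\mathbf{a}}=\frac{d!}{a_0!\,a_1!\cdots a_n!}$ is the multinomial coefficient, where $d=|\mathbf{a}|$. - $Z_{\mathbf{a}}=\{i : a_i=0\}$, $E_{\mathbf{a}}=\{i : a_i\text{ is even}\}$ (so $Z_{\mathbf a}\subset E_{\mathbf a}$), and $m_i=\lfloor\frac{a_i-1}{2}\rfloor$. - For a set $A$ with $Z_{\mathbf{a}}\subset A\subset E_{\mathbf{a}}$: $K_A=\{(k_i)_{i\notin A} : k_i\in\mathbb{Z},\ 0\le k_i\le m_i\text{ for } i\notin A\}$; $\overline{K_A}=\{(k_i)_{i\notin A}\in K_A : \min\{k_i\}_{i\notin A}=0\}$; $S_A=\{(s_i)_{i\notin A} : s_i\in\{0,1\}\}$; and $\overline{S_A}=\{(s_i)_{i\notin A}\in S_A : s_{\min\{i : i\notin A\}}=0\}$. - For $\mathbf{k}\in K_A$, $\mathbf{s}\in S_A$: $\ell_{A,\mathbf{k},\mathbf{s}}=\sum_{i\notin A}(-1)^{s_i}t^{k_i}X_i$, a linear form in $\Bbbk[X_0,\dots,X_n]$. - $F_i(y)\in\Bbbk[y]$ is $F_i(y)=\prod_{j=1}^{m_i}(y-t^{a_i-2j})$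 if $m_i>0$, and $F_i(y)=1$ if $m_i=-1$ or $m_i=0$. - For a monomial $M$ and a polynomial $f$ in $\Bbbk[y]$, $c(M,f)$ is the coefficient of $M$ in $f$. - For $\mathbf{k}\in K_A$, $\mathbf{s}\in\overline{S_A}$: $C_{A,\mathbf{k},\mathbf{s}}=(-1)^{|A|}\cdot 2^{|A|}\cdot(-1)^{\sum_{i\notin A}a_i s_i}\prod_{i\in A}F_i(1)\prod_{i\notin A}c(y^{k_i},F_i)$. Convention: if all $a_i$ are even, the choice $A=\{0,\dots,n\}$ is omitted from the sum (there is no associated linear form).
   Formalization: The formal theorem assumes d > 0: for a = (0,…,0) the only set A is {0,…,n}, which the convention omits, so the right side is 0 while the left side is (-1)^(n+1)·2^n, nonzero e.g. over the rationals. *)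

(* Defs.v *)
From mathcomp Require Import all_boot all_order all_algebra.
From mathcomp Require Import mpoly.
From mathcomp Require cardinality.

Set Implicit Arguments.
Unset Strict Implicit.
Unset Printing Implicit Defensive.

Import GRing.Theory.
Local Open Scope ring_scope.

Definition infinite_field (K : fieldType) : Prop :=
  cardinality.infinite_set (@classical_sets.setT K).

(* The minimum of a finite family of naturals. The seed is the maximum of the
   family, so it does not affect the result when [I] is nonempty (and the
   value is 0 when [I] is empty). *)
Definition min_fam (I : finType) (f : I -> nat) : nat :=
  \big[minn / (\max_i f i)%N]_i f i.

(* The index set {0, ..., n} \ A: families indexed by [i] not in [A] are
   families on this finite type. *)
Notation outside A := {i | i \notin A}.

Section Combinatorics.
Variables (n : nat) (a : 'I_n.+1 -> nat).
Implicit Type A : {set 'I_n.+1}.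

Definition deg : nat := (\sum_i a i)%N.

(* The division is exact. *)
Definition multinomial : nat := (deg`! %/ \prod_i (a i)`!)%N.

Definition zero_set : {set 'I_n.+1} := [set i | a i == 0%N].
Definition even_set : {set 'I_n.+1} := [set i | ~~ odd (a i)].

(* floor((a_i - 1) / 2), except that truncated subtraction gives 0 instead of
   -1 when a_i = 0. This is harmless: F_i = 1 in both cases, and otherwise
   m_i only occurs for i outside A, where a_i > 0. *)
Definition m (i : 'I_n.+1) : nat := (a i).-1./2.

(* Entries satisfy k_i <= m_i <= deg, so the codomain 'I_deg.+1 (which makes
   the type of families finite) loses nothing. *)
Definition K_set A : {set {ffun outside A -> 'I_deg.+1}} :=
  [set k : {ffun outside A -> 'I_deg.+1} | [forall i : outside A, (k i <= m (val i))%N]].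

Definition Kbar_set A : {set {ffun outside A -> 'I_deg.+1}} :=
  [set k in K_set A | min_fam (fun i => k i : nat) == 0%N].

(* S_A is the whole type {ffun outside A -> bool}, with true = 1 and
   false = 0; here s vanishes at the least index outside A. *)
Definition Sbar_set A : {set {ffun outside A -> bool}} :=
  [set s : {ffun outside A -> bool} |
    [forall i : outside A, (val i == min_fam (fun j : outside A => val j : nat) :> nat)
               ==> (s i == false)]].

End Combinatorics.

Section Coefficients.
Variables (K : fieldType) (t : K) (n : nat) (a : 'I_n.+1 -> nat).
Implicit Type A : {set 'I_n.+1}.

Definition lin_form A (k : outside A -> nat) (s : outside A -> bool) :
    {mpoly K[n.+1]} :=
  \sum_i ((-1) ^+ s i * t ^+ k i) *: 'X_(val i).

(* The product is empty when m_i is 0 (or -1), and a_i - 2j > 0 for the j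
   that occur. *)
Definition F (i : 'I_n.+1) : {poly K} :=
  \prod_(1 <= j < (m a i).+1) ('X - (t ^+ (a i - 2 * j))%:P).

Definition C A (k : outside A -> nat) (s : outside A -> bool) : K :=
  (-1) ^+ #|A| * 2%:R ^+ #|A| * (-1) ^+ (\sum_i a (val i) * s i)%N
  * (\prod_(i in A) (F i).[1]) * \prod_i (F (val i))`_(k i).

Definition Cbar A (k : outside A -> nat) (s : outside A -> bool) : K :=
  \sum_(0 <= j < (min_fam (fun i : outside A => m a (val i) - k i)%N).+1)
    t ^+ (deg a * j) * C (A := A) (fun i => (k i + j)%N) s.

Definition D : K :=
  (-1) ^+ #|zero_set a| * 2%:R ^+ n * (multinomial a)%:R
  * \prod_(i | i \notin zero_set a) (F i).[t ^+ a i].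

End Coefficients.

Arguments lin_form {K} t {n} A k s.
Arguments C {K} t {n} a A k s.
Arguments Cbar {K} t {n} a A k s.

(* Main.v *)
(* Compare the coefficients of X^b. Those of l^d are multinomial coefficients
   times monomials, so for a fixed A the sums over k and s factor over the
   indices: the sum over k gives the product of the F_i(t^(b_i)), and the sum
   over s forces b = a modulo 2. The sum over A factors in turn, into a product
   over i that vanishes as soon as some b_i < a_i, because the a_i - 2j are
   exactly the exponents of the roots of F_i. As |b| = |a|, only b = a remains.
   Passing from K_A to the tuples with minimum 0 only uses
   l_(k + j 1) = t^j l_k. *)
Require Import Defs.
From mathcomp Require Import all_boot all_order all_algebra mpoly.
From mathcomp Require Import zify ring.

Set Implicit Arguments.
Unset Strict Implicit.
Unset Printing Implicit Defensive.

Import GRing.Theory.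
Local Open Scope ring_scope.

(** * Coefficients of powers of linear forms *)

Lemma mderiv_exp (R : comNzRingType) (n d : nat) (i : 'I_n) (p : {mpoly R[n]}) :
  (p ^+ d.+1)^`M(i) = (p ^+ d * p^`M(i)) *+ d.+1.
Proof.
elim: d => [|d IHd]; first by rewrite expr1 expr0 mul1r.
by rewrite exprS mderivM IHd mulrnAr mulrA -exprS (mulrC p^`M(i)) -mulrS.
Qed.

(** Induction on the degree: differentiating in a variable [i] with [b i > 0] lowers that exponent
    by one and multiplies the coefficient by [b i]. Clearing denominators avoids any division in
    [R]. *)
Lemma mcoeff_sumX_exp_fact (R : comNzRingType) (n : nat) (b : 'X_{1..n}) :
  ((\sum_i 'X_i : {mpoly R[n]}) ^+ mdeg b)@_b * (\prod_i (b i)`!)%:R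
  = (mdeg b)`!%:R.
Proof.
move def_d: (mdeg b) => d; elim: d => [|d IHd] in b def_d *.
  have /eqP-> : b == 0%MM by rewrite -mdeg_eq0 def_d.
  rewrite expr0 mcoeff1 eqxx mul1r big1 // => i _.
  by rewrite mnm0E.
have [i bi_gt0] : exists i, (0 < b i)%N.
  apply/existsP; apply: contra_eqT def_d; rewrite negb_exists => /forallP b0.
  by rewrite mdegE big1 // => i _; apply/eqP; rewrite -leqn0 leqNgt b0.
pose c := (b - U_(i))%MM.
have def_b : b = (c + U_(i))%MM by rewrite submK // lep1mP -lt0n.
have def_c : mdeg c = d.
  by move: def_d; rewrite def_b mdegD mdeg1 addn1 => -[].
have -> : (\prod_j (b j)`! = (c i).+1 * \prod_j (c j)`!)%N.
  rewrite (bigD1 i) //= [in RHS](bigD1 i) //= mulnA -factS; congr (_ * _)%N.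
    by rewrite def_b mnmDE mnm1E eqxx addn1.
  by apply: eq_bigr => j ne_ji; rewrite def_b mnmDE mnm1E eq_sym (negPf ne_ji)
    addn0.
rewrite natrM mulrA [X in X * _]mulr_natr def_b -mcoeff_deriv mderiv_exp.
have -> : (\sum_j 'X_j : {mpoly R[n]})^`M(i) = 1.
  rewrite raddf_sum (bigD1 i) //= big1 => [|j ne_ji]; rewrite mderivX mnm1E.
    by rewrite eqxx scale1r -{1}[U_(i)%MM]add0m addmK mpolyX0 addr0.
  by rewrite (negPf ne_ji) scale0r.
by rewrite mulr1 mcoeffMn mulrnAl IHd // -mulrnA mulnC -factS.
Qed.

(** In positive characteristic the factorials may not cancel, so the coefficient is found over [int]
    and then mapped to [R]. *)
Lemma mcoeff_sumX_exp (R : comNzRingType) (n : nat) (b : 'X_{1..n}) :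
  ((\sum_i 'X_i : {mpoly R[n]}) ^+ mdeg b)@_b
  = (((mdeg b)`! %/ \prod_i (b i)`!)%N)%:R.
Proof.
set p := \prod_i (b i)`!; have p_gt0 : (0 < p)%N.
  by apply: prodn_gt0 => i; apply: fact_gt0.
have -> : \sum_i 'X_i = map_mpoly intr (\sum_i 'X_i) :> {mpoly R[n]}.
  by rewrite rmorph_sum; apply: eq_bigr => i _; rewrite /= map_mpolyX.
rewrite -rmorphXn /= mcoeff_map_mpoly.
have /= := mcoeff_sumX_exp_fact int b; rewrite -/p.
set z := _@_b => def_z.
have z_ge0 : 0 <= z.
  have p0 : (0 : int) < p%:R by rewrite Num.Theory.ltr0n.
  by rewrite -(Num.Theory.pmulr_lge0 _ p0) def_z Num.Theory.ler0n.
case: z z_ge0 def_z => // z _; rewrite !natz -PoszM => -[<-].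
by rewrite mulnK.
Qed.

(** The rescaling that turns the sum of the variables into a general linear form. *)
Lemma mcoeff_comp_scale (R : comNzRingType) (n : nat) (p : {mpoly R[n]})
    (c : 'I_n -> R) (b : 'X_{1..n}) :
  (p \mPo [tuple c i *: 'X_i | i < n])@_b = p@_b * \prod_i c i ^+ b i.
Proof.
rewrite comp_mpolyEX raddf_sum /=.
under eq_bigr => m _.
  rewrite comp_mpolyX.
  under eq_bigr => i _ do rewrite tnth_mktuple exprZn.
  rewrite scaler_prod -mpolyXE_id !mcoeffZ mcoeffX.
  over.
have [b_p|] := boolP (b \in msupp p).
  rewrite (bigD1_seq b) //= ?msupp_uniq // eqxx mulr1.
  rewrite [X in _ + X]big1 ?addr0 //.
  by move=> m /negPf->; rewrite !mulr0.
rewrite mcoeff_msupp negbK => /eqP p_b0; rewrite p_b0 mul0r big1_seq // => m /=.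
case: eqVneq => [->|_ _]; last by rewrite !mulr0.
by rewrite mcoeff_msupp p_b0 eqxx.
Qed.

Lemma mcoeff_linear_exp (R : comNzRingType) (n d : nat) (c : 'I_n -> R)
    (b : 'X_{1..n}) :
  ((\sum_i c i *: 'X_i) ^+ d)@_b =
  if mdeg b == d
  then (((mdeg b)`! %/ \prod_i (b i)`!)%N)%:R * \prod_i c i ^+ b i else 0.
Proof.
case: eqP => [<-|/eqP deg_b].
  rewrite -mcoeff_sumX_exp -mcoeff_comp_scale rmorphXn /= rmorph_sum /=.
  congr ((_ ^+ _)@_b); apply: eq_bigr => i _.
  by rewrite comp_mpolyXU -tnth_nth tnth_mktuple.
apply/(dhomog_nemf_coeff _ deg_b); rewrite -[d in d.-homog]mul1n.
apply: dhomogMn; apply: rpred_sum => i _; apply: rpredZ.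
by rewrite dhomogX /= mdeg1.
Qed.

(** * Minima of finite families *)

Lemma min_fam_le (I : finType) (f : I -> nat) (i : I) : (min_fam f <= f i)%N.
Proof.
rewrite /min_fam; move: (\max_i f i)%N => M.
elim: (index_enum I) (mem_index_enum i) => //= j r IHr.
rewrite inE big_cons => /orP[/eqP->|/IHr]; first exact: geq_minl.
by move=> le_r; rewrite geq_min le_r orbT.
Qed.

Lemma min_fam_attained (I : finType) (f : I -> nat) (i0 : I) :
  exists i, min_fam f = f i.
Proof.
apply: (big_ind (fun x => exists i, x = f i)) => [|_ _ [i ->] [j ->]|i _].
(* The seed is the maximum, itself a value of [f] because [i0] makes [I] nonempty. *)
- by have [|i ->] := @eq_bigmax I f; [apply/card_gt0P; exists i0 | exists i].
- by case: (leqP (f i) (f j)) => _; [exists i | exists j].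
- by exists i.
Qed.

Lemma eq_min_fam (I : finType) (f g : I -> nat) :
  f =1 g -> min_fam f = min_fam g.
Proof.
move=> fg; rewrite /min_fam.
have -> : (\max_i f i = \max_i g i)%N by apply: eq_bigr.
exact: eq_bigr.
Qed.

Lemma min_famDr (I : finType) (f : I -> nat) (j : nat) (i0 : I) :
  min_fam (fun i => f i + j)%N = (min_fam f + j)%N.
Proof.
apply/eqP; rewrite eqn_leq; apply/andP; split.
  have [i ->] := min_fam_attained f i0.
  exact: (min_fam_le (fun i => f i + j)%N i).
have [i ->] := min_fam_attained (fun i => f i + j)%N i0.
by rewrite leq_add2r min_fam_le.
Qed.

Lemma big_outside (R : Type) (idx : R) (op : Monoid.com_law idx) (I : finType)
    (A : {set I}) (f : I -> R) :
  \big[op/idx]_(i | i \notin A) f i = \big[op/idx]_(u : outside A) f (val u).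
Proof. exact: (big_sub [pred i | i \notin A]). Qed.

(** * Grouping tuples that differ by a constant *)

Section Regroup.
Variables (n : nat) (a : 'I_n.+1 -> nat).

Lemma m_le_deg (i : 'I_n.+1) : (m a i <= deg a)%N.
Proof.
apply: (@leq_trans (a i)); last by rewrite /deg (bigD1 i) //= leq_addr.
by rewrite /m (leq_trans (half_leq (leq_pred _))) // -divn2 leq_div.
Qed.

Lemma K_setP (A : {set 'I_n.+1}) (k : {ffun outside A -> 'I_(deg a).+1}) :
  reflect (forall u, k u <= m a (val u))%N (k \in K_set a A).
Proof. by rewrite inE; apply: forallP. Qed.

(** Each [k] in [K_set] is in exactly one way a tuple with minimum 0 plus a constant [j], namely its
    minimum; the upper bounds on the entries say that [j] is at most the least difference. The
    hypothesis on [G] stands in for functional extensionality. *)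
Lemma sum_Kbar_shift (V : nmodType) (A : {set 'I_n.+1}) (i0 : outside A)
    (G : (outside A -> nat) -> V) :
  (forall k k', k =1 k' -> G k = G k') ->
  \sum_(k in Kbar_set a A)
    \sum_(0 <= j < (min_fam (fun u : outside A => m a (val u) - k u)%N).+1)
      G (fun u => k u + j)%N
  = \sum_(k in K_set a A) G (fun u => k u).
Proof.
move=> eqG; pose kT := {ffun outside A -> 'I_(deg a).+1}.
pose Q (k : kT) := min_fam (fun u : outside A => m a (val u) - k u)%N.
pose mink (k : kT) := min_fam (fun u => k u : nat).
have Q_deg k : (Q k <= deg a)%N.
  exact: leq_trans (min_fam_le _ i0) (leq_trans (leq_subr _ _) (m_le_deg _)).
transitivity (\sum_(k in Kbar_set a A)
    \sum_(j < (deg a).+1 | (j <= Q k)%N) G (fun u => k u + j)%N).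
  apply: eq_bigr => k _; rewrite big_mkord.
  have Q_deg1 : ((Q k).+1 <= (deg a).+1)%N by rewrite ltnS Q_deg.
  by rewrite (big_ord_widen _ (fun j => G (fun u => k u + j)%N) Q_deg1).
rewrite pair_big_dep /=.
(* [h] adds the constant, [h'] splits off the minimum. On the pairs of the double sum the entries
   stay at most [deg a], so [inord] does not fall back to its default. *)
pose h (p : kT * 'I_(deg a).+1) : kT := [ffun u => inord (p.1 u + p.2)].
pose h' (k : kT) : kT * 'I_(deg a).+1 :=
  ([ffun u => inord (k u - mink k)], inord (mink k)).
have mink_le k u : (mink k <= k u)%N by apply: min_fam_le.
have h'1 k u : (h' k).1 u = (k u - mink k)%N :> nat.
  by rewrite ffunE inordK // ltnS (leq_trans (leq_subr _ _)) // -ltnS.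
have h'2 k : (h' k).2 = mink k :> nat.
  by rewrite inordK // (leq_ltn_trans (mink_le k i0)).
have hK k : h (h' k) = k.
  apply/ffunP => u; apply: val_inj; rewrite ffunE h'1 h'2 subnK //=.
  by rewrite inordK.
have h'Q k : k \in K_set a A ->
    ((h' k).1 \in Kbar_set a A) && ((h' k).2 <= Q (h' k).1)%N.
  move=> /K_setP k_m.
  have [u def_u] := min_fam_attained (fun u => k u : nat) i0.
  rewrite inE -andbA; apply/and3P; split.
  - by apply/K_setP => v; rewrite h'1 (leq_trans (leq_subr _ _)).
  - by rewrite -leqn0 (leq_trans (min_fam_le _ u)) // h'1 /mink def_u subnn.
  - rewrite /Q; have [v ->] := min_fam_attained
      (fun u : outside A => m a (val u) - (h' k).1 u)%N i0.
    by rewrite h'1 h'2 leq_subRL ?subnK // (leq_trans (leq_subr _ _)).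
have hE (p : kT * 'I_(deg a).+1) :
    p.1 \in Kbar_set a A -> (p.2 <= Q p.1)%N ->
    forall u, (p.1 u + p.2 <= m a (val u))%N /\ h p u = (p.1 u + p.2)%N :> nat.
  rewrite inE => /andP[/K_setP p1_m _] p2_Q u.
  have le_m : (p.1 u + p.2 <= m a (val u))%N.
    by rewrite -leq_subRL // (leq_trans p2_Q) ?(min_fam_le _ u).
  by split=> //; rewrite ffunE inordK // ltnS (leq_trans le_m) ?m_le_deg.
have h'K (p : kT * 'I_(deg a).+1) :
    p.1 \in Kbar_set a A -> (p.2 <= Q p.1)%N -> h' (h p) = p.
  move=> p1 p2; have hp u := (hE p p1 p2 u).2.
  have minhp : mink (h p) = p.2 :> nat.
    move: p1; rewrite inE => /andP[_ /eqP p1_0].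
    by rewrite /mink (eq_min_fam hp) min_famDr // p1_0.
  case: p {p1 p2} hp minhp => k j /= hp minhp.
  congr pair; last by apply: val_inj; rewrite /= h'2.
  by apply/ffunP => u; apply: val_inj; rewrite /= h'1 hp minhp addnK.
rewrite [RHS](reindex_onto h h') => [|k _]; last exact: hK.
apply: eq_big => [p|p /andP[p1 p2]]; last first.
  by apply: eqG => u; rewrite (hE p p1 p2 u).2.
(* Pairs outside the double sum are excluded: by [h'Q] they are not of the form [h' k] with [k] in
   [K_set]. *)
apply/andP/andP => [[p1 p2]|[hp /eqP def_p]]; last first.
  by have := h'Q _ hp; rewrite def_p => /andP[].
split; last by rewrite h'K.
by apply/K_setP => u; have [le_m ->] := hE p p1 p2 u.
Qed.

End Regroup.

(** * Factoring the sums over signs and exponents *)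

Lemma sum_Sbar_prod (R : comNzRingType) (n : nat) (A : {set 'I_n.+1})
    (x : outside A -> R) :
  \sum_(s in Sbar_set A) \prod_u x u ^+ s u =
  \prod_(u : outside A)
    (if val u == min_fam (fun v : outside A => val v : nat) :> nat
     then 1 else 1 + x u).
Proof.
set mu := min_fam _.
(* As [mu] does not depend on [s], membership in [Sbar_set] constrains each entry separately and the
   sum distributes; the least index keeps only its term 1. *)
pose Q (u : outside A) : pred bool :=
  fun b => (val u == mu :> nat) ==> (b == false).
transitivity (\sum_(s : {ffun outside A -> bool} | s \in family Q)
    \prod_u x u ^+ s u).
  by apply: eq_bigl => s; rewrite inE; apply/forallP/familyP.
rewrite -(bigA_distr_big_dep (I := outside A) Q (fun u (b : bool) => x u ^+ b)).
apply: eq_bigr => u _; rewrite big_mkcond big_bool /Q /=.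
by case: eqP => _ /=; rewrite ?add0r // addrC.
Qed.

Section Coefficients.
Variables (K : fieldType) (t : K) (n : nat) (a : 'I_n.+1 -> nat).
Implicit Types (A : {set 'I_n.+1}) (b : 'X_{1..n.+1}).

Lemma size_F (i : 'I_n.+1) : size (F t a i) = (m a i).+1.
Proof. by rewrite /F size_prod_XsubC size_iota subn1. Qed.

Lemma F_small (i : 'I_n.+1) : m a i = 0%N -> F t a i = 1.
Proof. by move=> m0; rewrite /F m0 big_geq. Qed.

Lemma F_eval_eq0 (i : 'I_n.+1) (j : nat) :
  (0 < j)%N -> (j < a i)%N -> odd j = odd (a i) -> (F t a i).[t ^+ j] = 0.
Proof.
move=> j_gt0 lt_j odd_j; have j_a := ltnW lt_j.
have def_j : ((a i - j)./2.*2 = a i - j)%N.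
  by rewrite -[RHS]odd_double_half oddB // odd_j addbb.
apply/eqP; rewrite /F horner_prod prodf_seq_eq0; apply/hasP.
(* Equal parity and the strict bounds on [j] place this half difference between 1 and [m a i]. *)
exists (a i - j)./2; last first.
  by rewrite /= hornerXsubC mul2n def_j subKn // subrr.
by rewrite mem_index_iota /m; lia.
Qed.

(** [K_set] is a product of ranges, and since [F] has degree [m a i] each range takes in all its
    coefficients. *)
Lemma sum_K_prod A (y : outside A -> K) :
  \sum_(k in K_set a A) \prod_u ((F t a (val u))`_(k u) * y u ^+ k u)
  = \prod_(u : outside A) (F t a (val u)).[y u].
Proof.
pose Q (u : outside A) : pred 'I_(deg a).+1 := fun k => (k <= m a (val u))%N.
transitivity (\sum_(k : {ffun outside A -> 'I_(deg a).+1} | k \in family Q)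
    \prod_u ((F t a (val u))`_(k u) * y u ^+ k u)).
  by apply: eq_bigl => k; rewrite inE; apply/forallP/familyP.
rewrite -(bigA_distr_big_dep (I := outside A) Q
  (fun u (k : 'I__) => (F t a (val u))`_k * y u ^+ k)).
apply: eq_bigr => u _.
rewrite (@horner_coef_wide _ (m a (val u)).+1) ?size_F //.
have le_m : ((m a (val u)).+1 <= (deg a).+1)%N by rewrite ltnS m_le_deg.
by rewrite (big_ord_widen _ (fun k => (F t a (val u))`_k * y u ^+ k) le_m).
Qed.

Lemma mcoeff_lin_form_exp A (k : outside A -> nat) (s : outside A -> bool)
    (d : nat) b :
  (lin_form t A k s ^+ d)@_b =
  if mdeg b == d
  then (((mdeg b)`! %/ \prod_i (b i)`!)%N)%:R *
       ((\prod_(i in A) (b i == 0%N)%:R) *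
        \prod_u ((-1) ^+ s u * t ^+ k u) ^+ b (val u))
  else 0.
Proof.
(* The form is extended by zero coefficients on [A]; as 0 to the power 0 is 1, these contribute the
   indicators of [b i = 0]. *)
pose c (i : 'I_n.+1) := if insub i is Some u then (-1) ^+ s u * t ^+ k u else 0.
have c_val (u : outside A) : c (val u) = (-1) ^+ s u * t ^+ k u.
  by rewrite /c valK.
have c_A i : i \in A -> c i = 0.
  by move=> iA; rewrite /c insubF ?iA.
have -> : lin_form t A k s = \sum_i c i *: 'X_i.
  rewrite /lin_form [RHS](bigID (mem A)) /= [X in X + _]big1 ?add0r => [|i iA].
    by rewrite big_outside; apply: eq_bigr => u _; rewrite c_val.
  by rewrite c_A ?scale0r.
rewrite mcoeff_linear_exp; case: eqP => // _; congr (_ * _).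
rewrite (bigID (mem A)) /= big_outside; congr (_ * _).
  by apply: eq_bigr => i iA; rewrite c_A // expr0n.
by apply: eq_bigr => u _; rewrite c_val.
Qed.

Lemma odd_sum_even (I : finType) (P : pred I) (f : I -> nat) :
  (forall i, P i -> ~~ odd (f i)) -> odd (\sum_(i | P i) f i) = false.
Proof.
move=> f_even; apply/negbTE/(big_ind (fun x => ~~ odd x)) => // x y.
by rewrite oddD => /negPf-> /negPf->.
Qed.

Lemma add1_sign (R : pzRingType) (j : nat) :
  1 + (-1) ^+ j = (~~ odd j)%:R *+ 2 :> R.
Proof.
by rewrite -signr_odd; case: (odd j); rewrite ?expr1 ?subrr ?mul0rn ?mulr2n.
Qed.

(* The factor missing at the least index outside [A] is supplied by the parity
   of the degree. *)
Lemma prod_sign_parity A b (i0 : outside A) :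
  A \subset even_set a -> mdeg b = deg a ->
  \prod_(i in A) (b i == 0%N)%:R *
    \prod_(u : outside A)
      (if val u == min_fam (fun v : outside A => val v : nat) :> nat
       then 1 else 1 + (-1) ^+ (a (val u) + b (val u)))
  = 2%:R ^+ (n - #|A|) * (\prod_(i in A) (b i == 0%N)%:R *
      \prod_(u : outside A) (odd (a (val u)) == odd (b (val u)))%:R) :> K.
Proof.
move=> A_even deg_b; rewrite mulrCA.
have [bA|] := boolP [forall i in A, b i == 0%N]; last first.
  rewrite negb_forall_in => /exists_inP[i iA bi].
  by rewrite (bigD1 i) //= (negPf bi) !mul0r.
congr (_ * _).
have [u0 def_min] := min_fam_attained (fun v : outside A => val v : nat) i0.
rewrite def_min (bigD1 u0) //= eqxx mul1r [in RHS](bigD1 u0) //=.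
(* Of the [n + 1 - #|A|] indices outside [A] one has its sign frozen; each of the others can yield a
   factor 2. *)
have card_out : #|predC1 u0| = (n - #|A|)%N.
  have /eqP := cardC1 u0; rewrite card_sig => /eqP->.
  have /eqP := cardC (mem A); rewrite card_ord => /eqP.
  rewrite (_ : #|[pred i | i \notin A]| = #|predC (mem A)|); last first.
    exact: eq_card.
  by move: #|predC _| #|mem A| => p q; lia.
have -> : \prod_(u : outside A | u != u0)
      (if val u == val u0 :> nat then 1
       else 1 + (-1) ^+ (a (val u) + b (val u)))
  = 2%:R ^+ (n - #|A|) * \prod_(u : outside A | u != u0)
      (odd (a (val u)) == odd (b (val u)))%:R :> K.
  rewrite -card_out -prodr_const -big_split /=; apply: eq_bigr => u ne_u.
  rewrite (inj_eq val_inj) (inj_eq val_inj) (negPf ne_u).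
  by rewrite add1_sign oddD negb_add mulr_natl.
congr (_ * _).
have [ab|] := boolP [forall (u : outside A | u != u0),
    odd (a (val u)) == odd (b (val u))]; last first.
  rewrite negb_forall_in => /exists_inP[u ne_u ab].
  by rewrite (bigD1 u) //= (negPf ab) mul0r mulr0.
(* All the [a i + b i] sum to twice the degree and every index other than [u0] contributes an even
   amount, so [u0] does too. *)
suff -> : odd (a (val u0)) == odd (b (val u0)) by rewrite mul1r.
have : odd (\sum_i (a i + b i)) = false.
  by rewrite big_split /= -mdegE deg_b /deg addnn odd_double.
rewrite (bigID (mem A)) /= big_outside (bigD1 u0) //= !oddD.
rewrite !odd_sum_even /= ?addbF => [|u ne_u|i iA].
- by case: (odd _); case: (odd _).
- by have /forall_inP/(_ u ne_u)/eqP ab_u := ab; rewrite oddD ab_u addbb.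
- have /forall_inP/(_ i iA)/eqP-> := bA.
  by rewrite addn0; have := subsetP A_even i iA; rewrite inE.
Qed.

(** Each summand is a constant times a factor in [k] and a factor in [s]. The powers of [t] regroup
    as [(t ^+ b (val u)) ^+ k u], hence the values of [F] at [t ^+ b i]. The exponents of 2 from [C]
    and from the signs add up to [n] whatever [A] is, so that the sum over [A] can factor later. *)
Lemma sum_fixed_A A b (i0 : outside A) :
  A \subset even_set a -> mdeg b = deg a ->
  \sum_(k in K_set a A) \sum_(s in Sbar_set A)
    C t a A (fun u => k u) s * (lin_form t A (fun u => k u) s ^+ deg a)@_b
  = (((deg a)`! %/ \prod_i (b i)`!)%N)%:R * 2%:R ^+ n *
    \prod_i (if i \in A then - ((b i == 0%N)%:R * (F t a i).[1])
             else (odd (a i) == odd (b i))%:R * (F t a i).[t ^+ b i]).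
Proof.
move=> A_even deg_b; set N := _%:R.
pose ZA : K := \prod_(i in A) (b i == 0%N)%:R.
pose FA : K := \prod_(i in A) (F t a i).[1].
transitivity (\sum_(k in K_set a A) \sum_(s in Sbar_set A)
    ((-1) ^+ #|A| * 2%:R ^+ #|A| * N * FA * ZA) *
    ((\prod_u ((F t a (val u))`_(k u) * (t ^+ b (val u)) ^+ k u)) *
     (\prod_(u : outside A) ((-1) ^+ (a (val u) + b (val u))) ^+ s u))).
  apply: eq_bigr => k _; apply: eq_bigr => s _.
  rewrite mcoeff_lin_form_exp deg_b eqxx -/N -/ZA /C -/FA.
  rewrite -prodrXr /=.
  have -> : \prod_(u : outside A) ((-1) ^+ s u * t ^+ k u) ^+ b (val u)
     = (\prod_(u : outside A) (-1) ^+ (b (val u) * s u)%N) *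
       (\prod_(u : outside A) (t ^+ b (val u)) ^+ k u).
    rewrite -big_split; apply: eq_bigr => u _ /=.
    by rewrite exprMn -!exprM mulnC [(k u * _)%N]mulnC.
  have -> : \prod_(u : outside A) ((-1) ^+ (a (val u) + b (val u))) ^+ s u
     = (\prod_(u : outside A) (-1) ^+ (a (val u) * s u)%N) *
       (\prod_(u : outside A) (-1) ^+ (b (val u) * s u)%N) :> K.
    rewrite -big_split; apply: eq_bigr => u _ /=.
    by rewrite -exprD -mulnDl exprM.
  by rewrite big_split /=; ring.
under [LHS]eq_bigr => k _ do rewrite -mulr_sumr -mulr_sumr sum_Sbar_prod.
rewrite -mulr_sumr -mulr_suml sum_K_prod.
rewrite [in RHS](bigID (mem A)) /=.
have -> : \prod_(i in A) (if i \in A then - ((b i == 0%N)%:R * (F t a i).[1])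
             else (odd (a i) == odd (b i))%:R * (F t a i).[t ^+ b i])
   = (-1) ^+ #|A| * (ZA * FA).
  rewrite -prodr_const -!big_split; apply: eq_bigr => i -> /=.
  by rewrite mulN1r.
rewrite big_outside /=.
under [in RHS]eq_bigr => u _ do rewrite (negPf (valP u)).
rewrite big_split /= -/N.
set FB := \prod_u _.[_]; set S1 := \prod_u _; set S2 := \prod_u (_ == _)%:R.
have parity : ZA * S1 = 2%:R ^+ (n - #|A|) * (ZA * S2).
  exact: prod_sign_parity.
have -> : 2%:R ^+ n = 2%:R ^+ #|A| * 2%:R ^+ (n - #|A|) :> K.
  rewrite -exprD subnKC //.
  (* [i0] lies outside [A], so [#|A| <= n] and the truncated difference is exact. *)
  have /subset_leq_card : A \subset [set~ val i0]
    by apply/subsetP => i iA; rewrite !inE; apply: contraNneq (valP i0) => <-.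
  by rewrite cardsC1 card_ord.
transitivity ((-1) ^+ #|A| * 2%:R ^+ #|A| * N * FA * FB * (ZA * S1)).
  by ring.
by rewrite parity; ring.
Qed.

(** * From tuples with minimum 0 to all tuples *)

Lemma eq_C A (k k' : outside A -> nat) (s : outside A -> bool) :
  k =1 k' -> C t a A k s = C t a A k' s.
Proof.
by move=> kk'; rewrite /C; congr (_ * _); apply: eq_bigr => u _; rewrite kk'.
Qed.

Lemma eq_lin_form A (k k' : outside A -> nat) (s : outside A -> bool) :
  k =1 k' -> lin_form t A k s = lin_form t A k' s.
Proof. by move=> kk'; apply: eq_bigr => u _; rewrite kk'. Qed.

Lemma lin_form_shift A (k : outside A -> nat) (s : outside A -> bool)
    (j : nat) :
  lin_form t A (fun u => k u + j)%N s = t ^+ j *: lin_form t A k s.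
Proof.
rewrite scaler_sumr; apply: eq_bigr => u _.
by rewrite scalerA mulrCA -exprD addnC.
Qed.

(** The weight [t ^+ (deg a * j)] in [Cbar] is the [deg a]-th power of the scalar by which shifting
    [k] by [j] multiplies the form. *)
Lemma Cbar_scale_lin_form A (k : outside A -> nat) (s : outside A -> bool) :
  Cbar t a A k s *: lin_form t A k s ^+ deg a =
  \sum_(0 <= j < (min_fam (fun u : outside A => m a (val u) - k u)%N).+1)
    C t a A (fun u => k u + j)%N s *:
      lin_form t A (fun u => k u + j)%N s ^+ deg a.
Proof.
rewrite scaler_suml; apply: eq_bigr => j _.
by rewrite lin_form_shift exprZn scalerA mulrC -exprM mulnC.
Qed.

Lemma sum_Cbar A (i0 : outside A) :
  \sum_(k in Kbar_set a A) \sum_(s in Sbar_set A)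
    Cbar t a A (fun u => k u) s *: lin_form t A (fun u => k u) s ^+ deg a
  = \sum_(k in K_set a A) \sum_(s in Sbar_set A)
    C t a A (fun u => k u) s *: lin_form t A (fun u => k u) s ^+ deg a.
Proof.
rewrite -(@sum_Kbar_shift _ a _ A i0 (fun k => \sum_(s in Sbar_set A)
  C t a A k s *: lin_form t A k s ^+ deg a)) => [|k k' kk'].
  apply: eq_bigr => k _; rewrite exchange_big; apply: eq_bigr => s _.
  exact: Cbar_scale_lin_form.
by apply: eq_bigr => s _; rewrite (eq_C _ kk') (eq_lin_form _ kk').
Qed.

(* Summing the products over [A] factors; at an index with [a i] even and
   nonzero the two choices cancel when [b i = 0], and the roots of [F] cover
   the remaining [b i < a i]. *)
Lemma sum_A_prod b : (0 < deg a)%N -> mdeg b = deg a ->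
  \sum_(A : {set 'I_n.+1} |
        [&& zero_set a \subset A, A \subset even_set a & A != [set: 'I_n.+1]])
    \prod_i (if i \in A then - ((b i == 0%N)%:R * (F t a i).[1])
             else (odd (a i) == odd (b i))%:R * (F t a i).[t ^+ b i])
  = if [forall i, b i == a i]
    then (-1) ^+ #|zero_set a| *
         \prod_(i | i \notin zero_set a) (F t a i).[t ^+ a i]
    else 0.
Proof.
move=> deg_gt0 deg_b.
(* When the product of the [P i + Q i] is expanded, the zero values of [Q] on [zero_set] and of [P]
   off [even_set] enforce the two inclusions on [A]. *)
pose P i : K := if i \in even_set a
                then - ((b i == 0%N)%:R * (F t a i).[1]) else 0.
pose Q i : K := if i \in zero_set a then 0
                else (odd (a i) == odd (b i))%:R * (F t a i).[t ^+ b i].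
transitivity (\prod_i (P i + Q i)).
  rewrite bigA_distr big_mkcond; apply: eq_bigr => A _.
  case: ifPn => [/and3P[ZA AE _]|].
    apply: eq_bigr => i _; rewrite /P /Q; case: ifP => iA.
      by rewrite (subsetP AE).
    by rewrite ifN //; apply: contraFN iA => /(subsetP ZA).
  rewrite !negb_and negbK.
  move=> /or3P[/subsetPn[i iZ iA]|/subsetPn[i iA iE]|/eqP->].
  - by rewrite (bigD1 i) //= (negPf iA) /Q iZ mul0r.
  - by rewrite (bigD1 i) //= iA /P (negPf iE) mul0r.
  (* The omitted [A] contributes nothing, as [b] is nonzero. *)
  have [i bi] : exists i, b i != 0%N.
    apply/existsP; apply: contraTT deg_gt0; rewrite negb_exists -deg_b mdegE.
    move=> /forallP b0; rewrite big1 // => i _.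
    by apply/eqP; rewrite -[_ == _]negbK.
  by rewrite (bigD1 i) //= inE /P (negPf bi) mul0r oppr0 if_same mul0r.
case: ifPn => [/forallP ba|].
  rewrite (bigID (mem (zero_set a))) /=; congr (_ * _).
    (* Where [a i = 0], [F] is 1 and the factor is -1, whence the sign in [D]. *)
    rewrite -prodr_const; apply: eq_bigr => i iZ; rewrite /P /Q iZ addr0.
    have ai0 : a i = 0%N by apply/eqP; rewrite inE in iZ.
    by rewrite inE (eqP (ba i)) ai0 F_small ?hornerC ?mulr1 // /m ai0.
  apply: eq_bigr => i iZ; rewrite /P /Q (negPf iZ) (eqP (ba i)) eqxx mul1r.
  have ai0 : a i != 0%N by rewrite inE in iZ.
  by rewrite (negPf ai0) mul0r oppr0 if_same add0r.
(* If [a i <= b i] held everywhere, equal sums would force equality. *)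
move=> ne_ba; have [i lt_i] : exists i, (b i < a i)%N.
  apply/existsP; apply: contraR ne_ba; rewrite negb_exists => /forallP le_ab.
  have {}le_ab i : (a i <= b i)%N by rewrite leqNgt.
  have := (leqif_sum (P := xpredT) (fun i _ => leqif_eq (le_ab i))).2.
  rewrite -mdegE deg_b eqxx => /esym/forallP ab.
  by apply/forallP => i; rewrite eq_sym; apply: (ab i).
rewrite (bigD1 i) //= [X in X * _](_ : _ = 0) ?mul0r //.
have ai0 : a i != 0%N by rewrite -lt0n (leq_trans _ lt_i).
rewrite /P /Q !inE (negPf ai0).
(* At [b i = 0] both arguments of [F] are 1: the terms cancel for [a i] even and both vanish for
   [a i] odd. *)
have [b0|bn0] := posnP (b i).
  by rewrite b0 expr0; case: (odd _); rewrite /= ?mul1r ?addNr ?mul0r ?addr0.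
rewrite mul0r oppr0 if_same add0r.
by case: eqP => [odd_ab|_]; rewrite ?mul0r // F_eval_eq0 ?mulr0.
Qed.

End Coefficients.

(* The degree is assumed positive: for a = 0 the right-hand side is an empty
   sum, since A = {0, ..., n} is omitted, while the left-hand side is
   (-1)^(n+1) * 2^n. *)
Theorem corollary2p5 (K : fieldType) (K_infinite : infinite_field K) (t : K)
    (n : nat) (a : 'I_n.+1 -> nat) (deg_gt0 : (0 < deg a)%N) :
  D t a *: \prod_(i < n.+1) ('X_i ^+ a i : {mpoly K[n.+1]}) =
  \sum_(A : {set 'I_n.+1} |
          [&& zero_set a \subset A, A \subset even_set a & A != [set: 'I_n.+1]])
    \sum_(k in Kbar_set a A) \sum_(s in Sbar_set A)
      Cbar t a A (fun i => k i) s *: lin_form t A (fun i => k i) s ^+ deg a.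
Proof.
(* The lemmas for a fixed [A] take an index outside [A] as data; a proper [A] provides one by
   choice. *)
have out A : A != [set: 'I_n.+1] -> outside A.
  move=> A_ne; suff /sigW[i iA] : exists i, i \notin A by exists i.
  by apply/existsP; rewrite -negb_forall; apply: contra A_ne => /forallP AT;
     apply/eqP/setP => i; rewrite inE AT.
transitivity (\sum_(A : {set 'I_n.+1} |
          [&& zero_set a \subset A, A \subset even_set a & A != [set: 'I_n.+1]])
    \sum_(k in K_set a A) \sum_(s in Sbar_set A)
      C t a A (fun i => k i) s *: lin_form t A (fun i => k i) s ^+ deg a);
  last first.
  by apply: eq_bigr => A /and3P[_ _ /out i0]; rewrite sum_Cbar.
pose ma : 'X_{1..n.+1} := [multinom a i | i < n.+1].
have deg_ma : mdeg ma = deg a.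
  by rewrite mdegE; apply: eq_bigr => i _; rewrite mnmE.
have -> : \prod_(i < n.+1) ('X_i ^+ a i : {mpoly K[n.+1]}) = 'X_[ma].
  by rewrite mpolyXE_id; apply: eq_bigr => i _; rewrite mnmE.
apply/mpolyP => b; rewrite mcoeffZ mcoeffX !raddf_sum /=.
(* Both sides are homogeneous of degree [deg a], so other monomials have coefficient 0. *)
have [deg_b|deg_b] := eqVneq (mdeg b) (deg a); last first.
  have /negPf-> : ma != b by apply: contra_neq deg_b => <-.
  rewrite mulr0 big1 // => A _; rewrite raddf_sum big1 // => k _.
  rewrite raddf_sum big1 // => s _.
  by rewrite /= mcoeffZ mcoeff_lin_form_exp (negPf deg_b) mulr0.
transitivity ((((deg a)`! %/ \prod_i (b i)`!)%N)%:R * 2%:R ^+ n *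
  \sum_(A : {set 'I_n.+1} |
        [&& zero_set a \subset A, A \subset even_set a & A != [set: 'I_n.+1]])
    \prod_i (if i \in A then - ((b i == 0%N)%:R * (F t a i).[1])
             else (odd (a i) == odd (b i))%:R * (F t a i).[t ^+ b i]));
  last first.
  rewrite mulr_sumr; apply: eq_bigr => A /and3P[_ AE /out i0].
  rewrite -(sum_fixed_A t i0) // raddf_sum; apply: eq_bigr => k _ /=.
  by rewrite raddf_sum; apply: eq_bigr => s _; rewrite /= mcoeffZ.
rewrite sum_A_prod //.
have -> : (ma == b) = [forall i, b i == a i].
  apply/eqP/forallP => [<- i|ba]; first by rewrite mnmE.
  by apply/mnmP => i; rewrite mnmE (eqP (ba i)).
case: ifPn => [/forallP ba|_]; last by rewrite !mulr0.
have -> : (\prod_i (b i)`! = \prod_i (a i)`!)%N.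
  by apply: eq_bigr => i _; rewrite (eqP (ba i)).
by rewrite /D /multinomial mulr1; ring.
Qed.
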